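(* Let $R$ be a standard graded $k$-algebra that has a Conca generator, and set $e=\operatorname{rank}_kR_1$ and $r=\operatorname{rank}_kR_2$. Let $p\ge1$ and $q\ge0$ be integers. The linear locus $\boldsymbol L_{p,q}(R)\subseteq \operatorname{M}_{ep\times q}(k)$ is not empty when $q\le (e-1)p$, and has non-empty interior in $\operatorname{M}_{ep\times q}(k)$ when $q\le\max\{e-1,\,(e-r)p\}$.
   Context: $k$ is a field. A standard graded $k$-algebra is a commutative graded algebra $R=\bigoplus_{j\ge0}R_j$ with $R_0=k$, generated over $k$ by finitely many elements of degree one. Modules are finitely generated and $\mathbb Z$-graded. The graded Betti number is $\beta^R_{i,j}(M)=\operatorname{rank}_k\operatorname{Tor}^R_i(M,k)_j$. A non-zero graded module $M$ is Koszul if $\beta^R_{i,j}(M)=0$ for all $j\ne i$. A Conca generator of $R$ is a non-zero element $x\in R_1$ with $xR_1=R_2$ and $x^2=0$. Multiplication tables. Fix a $k$-basis $x_1,\dots,x_e$ of $R_1$. Let $k^{p,q}$ be the graded vector space with basis $u_1,\dots,u_p$ in degree $0$ and $v_1,\dots,v_q$ in degree $1$. $\operatorname{M}_{ep\times q}(k)$ denotes the set of $ep\times q$ matrices over $k$ with rows indexed by pairs $(l,n)\in\{1,\dots,e\}\times\{1,\dots,p\}$ and columns by $\{1,\dots,q\}$; it is identified with the affine space $\mathbb A^{epq}_k$ with the Zariski topology (closed sets are the zero sets of polynomials in the entries; for $q=0$ it is a single point). Each matrix $C=(c_{(l,n),h})$ defines a graded $R$-module $R^C$ with underlying vector space $k^{p,q}$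 by $x_lu_n=\sum_{h=1}^qc_{(l,n),h}v_h$ and $R_1v_h=0$. The linear locus is $\boldsymbol L_{p,q}(R)=\{C\in\operatorname{M}_{ep\times q}(k)\mid R^C\text{ is a Koszul }R\text{-module}\}$. The interior of a subset is the largest open set contained in it. *)

(* Defs.v *)
From HB Require Import structures.
From Stdlib Require Import ClassicalEpsilon.
From mathcomp Require Import all_boot all_order all_algebra.
From mathcomp.multinomials Require Import mpoly.

Set Implicit Arguments.
Unset Strict Implicit.
Unset Printing Implicit Defensive.

Import GRing.Theory.
Local Open Scope ring_scope.

(* The decomposition R = \bigoplus_(i >= 0) R_i is encoded by the projections
   hcomp i : R -> R onto the summands. *)
Record std_grading (k : fieldType) (R : comAlgType k) := StdGrading {
  hcomp : nat -> {linear R -> R};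
  hcompK : forall i j a, hcomp i (hcomp j a) = if i == j then hcomp j a else 0;
  hcomp_sum : forall a, exists n, a = \sum_(i < n) hcomp i a;
  hcompM : forall i j a b,
    hcomp (i + j) (hcomp i a * hcomp j b) = hcomp i a * hcomp j b;
  hcomp_base : forall a, hcomp 0 a = a <-> exists c : k, a = c%:A;
  std_generated : exists (n : nat) (g : 'I_n -> R),
    (forall i, hcomp 1 (g i) = g i) /\
    (forall a, exists P : {mpoly k[n]}, a = mmap (in_alg R) g P)
}.

Section Grading.
Variables (k : fieldType) (R : comAlgType k) (G : std_grading R).

Definition in_deg (i : nat) (a : R) : Prop := hcomp G i a = a.

(* Degrees extended to the integers, with R_z = 0 for z < 0. *)
Definition hcompz (z : int) (a : R) : R := if z is Posz n then hcomp G n a else 0.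

Definition in_degz (z : int) (a : R) : Prop := hcompz z a = a.

Definition conca_generator (x : R) : Prop :=
  [/\ x != 0, in_deg 1 x,
      (forall a, in_deg 2 a <-> exists2 b, in_deg 1 b & a = x * b) &
      x ^+ 2 = 0].

Definition is_basis (V : lmodType k) (S : V -> Prop) (n : nat)
    (b : 'I_n -> V) : Prop :=
  (forall i, S (b i)) /\
  (forall v, S v -> exists! c : 'rV[k]_n, v = \sum_i c 0 i *: b i).

Definition has_rank (V : lmodType k) (S : V -> Prop) (n : nat) : Prop :=
  exists b : 'I_n -> V, is_basis S b.

Lemma aug_ex a : exists c : k, hcomp G 0 a == c%:A.
Proof.
have [c ->] : exists c : k, hcomp G 0 a = c%:A.
  by apply/(hcomp_base G); rewrite hcompK eqxx.
by exists c.
Qed.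

(* The augmentation R -> R_0 = k. *)
Definition aug (a : R) : k := xchoose (aug_ex a).

Lemma augE a : hcomp G 0 a = (aug a)%:A.
Proof. exact/eqP/(xchooseP (aug_ex a)). Qed.

Lemma alg_inj : injective (fun c : k => c%:A : R).
Proof. exact: (fmorph_inj (in_alg R)). Qed.

Lemma aug_is_additive : zmod_morphism aug.
Proof. by move=> a b; apply: alg_inj; rewrite /= scalerBl -!augE linearB. Qed.

HB.instance Definition _ := GRing.isZmodMorphism.Build R k aug aug_is_additive.

Lemma hcomp_split a n :
  exists m : nat, (n <= m)%N /\ a = \sum_(i < m) hcomp G i a.
Proof.
have [m am] := hcomp_sum G a.
exists (n + m)%N; split; first exact: leq_addr.
rewrite addnC big_split_ord /= -am big1 ?addr0 // => i _.
rewrite [X in hcomp G _ X]am linear_sum big1 // => j _.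
by rewrite hcompK gtn_eqF // (leq_trans (ltn_ord j)) ?leq_addr.
Qed.

Lemma hcomp1 : hcomp G 0 1 = 1.
Proof. by apply/(hcomp_base G); exists 1; rewrite scale1r. Qed.

Lemma hcompM_off n i j a b : n != (i + j)%N ->
  hcomp G n (hcomp G i a * hcomp G j b) = 0.
Proof. by move=> nij; rewrite -hcompM hcompK (negPf nij). Qed.

Lemma hcomp_mulE n a b :
  hcomp G n (a * b) = \sum_(i < n.+1) hcomp G i a * hcomp G (n - i) b.
Proof.
have [m [nm am]] := hcomp_split a n.+1.
have [m' [nm' bm']] := hcomp_split b n.+1.
rewrite [in LHS]am [in LHS]bm' big_distrlr linear_sum /=.
rewrite (big_ord_widen _ (fun i => hcomp G i a * hcomp G (n - i) b) nm) /=.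
rewrite [RHS]big_mkcond /=; apply: eq_bigr => i _; rewrite linear_sum /=.
case: ltnP => [ltin|leni].
  have lt : (n - i < m')%N by apply: leq_trans nm'; rewrite ltnS leq_subr.
  rewrite (bigD1 (Ordinal lt)) //= -{1}(@subnKC i n) ?hcompM; last by [].
  rewrite big1 ?addr0 // => j /eqP nj; rewrite hcompM_off //.
  apply: contra_not_neq nj => e; apply/val_inj => /=.
  by rewrite e addKn.
rewrite big1 // => j _; rewrite hcompM_off //.
by rewrite ltn_eqF // (leq_trans leni) ?leq_addr.
Qed.

Lemma aug_is_monoid_morphism : monoid_morphism aug.
Proof.
split=> [|a b]; apply: alg_inj => /=.
  by rewrite -augE hcomp1 scale1r.
by rewrite -augE hcomp_mulE big_ord1 subnn !augE mulr_algl scalerA.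
Qed.

HB.instance Definition _ :=
  GRing.isMonoidMorphism.Build R k aug aug_is_monoid_morphism.

Record mod_grading (M : lmodType R) := ModGrading {
  mcomp : int -> {additive M -> M};
  mcompK : forall i j m, mcomp i (mcomp j m) = if i == j then mcomp j m else 0;
  mcomp_sum : forall m, exists2 s : seq int, uniq s & m = \sum_(j <- s) mcomp j m;
  mcompZ : forall (i : nat) (j : int) a m,
    mcomp (i%:Z + j) (hcomp G i a *: mcomp j m) = hcomp G i a *: mcomp j m
}.

(* The sequence of graded free modules F_i = \bigoplus_s R(- shift i s), whose
   elements are the row vectors v : 'rV_(rk i), with the maps v |-> v *m diff i
   from F_(i+1) to F_i. *)
Record free_seq := FreeSeq {
  rk : nat -> nat;
  shift : forall i, 'I_(rk i) -> int;
  diff : forall i, 'M[R]_(rk i.+1, rk i)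
}.

(* F, augmented by the map F_0 -> M sending the s-th basis vector to gen s, is a
   graded free resolution of M.  Every finitely generated graded R-module has a
   resolution by modules of finite rank, as R is noetherian. *)
Definition free_resolution (M : lmodType R) (MG : mod_grading M)
    (F : free_seq) : Prop :=
  (forall i s t, in_degz (shift s - shift t) (diff F i s t)) /\
  (forall i (v : 'rV[R]_(rk F i.+1)),
     v *m diff F i = 0 <-> exists w, v = w *m diff F i.+1) /\
  exists gen : 'I_(rk F 0) -> M,
    [/\ forall s, mcomp MG (shift s) (gen s) = gen s,
        forall m, exists v : 'rV[R]_(rk F 0), m = \sum_s v 0 s *: gen s &
        forall v : 'rV[R]_(rk F 0),
          \sum_s v 0 s *: gen s = 0 <-> exists w, v = w *m diff F 0].

Section Tor.
Variable F : free_seq.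

(* In F \otimes_R k: the differentials, the cycles, and the span of the basis
   vectors of degree j, the last two given as row spaces. *)
Definition kdiff i : 'M[k]_(rk F i.+1, rk F i) := map_mx aug (diff F i).

Definition kcycles i : 'M[k]_(rk F i) :=
  match i with 0%N => 1%:M | i'.+1 => kermx (kdiff i') end.

Definition degpart i (j : int) : 'M[k]_(rk F i) :=
  diag_mx (\row_s (shift s == j)%:R).

Definition homology_rank (i : nat) (j : int) : nat :=
  (\rank (kcycles i :&: degpart i j) - \rank (kdiff i :&: degpart i j))%N.

End Tor.

Lemma hcompz_is_additive z : zmod_morphism (hcompz z).
Proof. by case: z => n a b /=; rewrite ?linearB ?subr0. Qed.

HB.instance Definition _ z :=
  GRing.isZmodMorphism.Build R R (hcompz z) (hcompz_is_additive z).

Lemma hcompzK z a : in_degz z (hcompz z a).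
Proof. by case: z => n; rewrite /in_degz //= hcompK eqxx. Qed.

Lemma hcompz_mul z y a b : in_degz y b -> hcompz (z + y) (a * b) = hcompz z a * b.
Proof.
case: y => m; last by rewrite /in_degz /= => <-; rewrite !mulr0 raddf0.
rewrite /in_degz /= => bm.
have mulE n : hcomp G n (a * b) = if (m <= n)%N then hcomp G (n - m) a * b else 0.
  rewrite hcomp_mulE; case: leqP => mn.
    have lt : (n - m < n.+1)%N by rewrite ltnS leq_subr.
    rewrite (bigD1 (Ordinal lt)) //= subKn // bm big1 ?addr0 // => i /eqP ni.
    rewrite -bm hcompK ifN ?mulr0 //; apply: contra_not_neq ni => e.
    by apply/val_inj; rewrite /= -e subKn // -ltnS.
  rewrite big1 // => i _; rewrite -bm hcompK ifN ?mulr0 //.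
  by rewrite ltn_eqF // (leq_ltn_trans (leq_subr _ _)).
case: z => n /=; first by rewrite mulE leq_addl addnK.
rewrite mul0r NegzE addrC; case: (leqP n.+1 m) => nm.
  by rewrite subzn //= mulE ifN // -ltnNge ltn_subrL /= (leq_trans _ nm).
by rewrite -[m%:Z - _]opprB subzn 1?ltnW // -(subnSK nm) -NegzE.
Qed.

Lemma in_degzM y z a b : in_degz y a -> in_degz z b -> in_degz (y + z) (a * b).
Proof. by move=> ay bz; rewrite /in_degz hcompz_mul // ay. Qed.

Lemma in_degz_sum I (s : seq I) z (f : I -> R) :
  (forall i, in_degz z (f i)) -> in_degz z (\sum_(i <- s) f i).
Proof. by move=> fz; rewrite /in_degz raddf_sum; apply: eq_bigr => i _; apply: fz. Qed.

Lemma aug_in_degz z a : in_degz z a -> z != 0 -> aug a = 0.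
Proof.
case: z => n; rewrite /in_degz /= => <- nz; last by rewrite raddf0.
have n0 : (0%N == n) = false by case: n nz {a}.
by apply: alg_inj; rewrite /= -augE hcompK n0 scale0r.
Qed.

Lemma mcomp_scale (M : lmodType R) (MG : mod_grading M) z y a m :
  mcomp MG y m = m -> mcomp MG (z + y) (a *: m) = hcompz z a *: m.
Proof.
move=> my.
have mE w (i : nat) : mcomp MG w (hcomp G i a *: m) =
    if w == i%:Z + y then hcomp G i a *: m else 0.
  by rewrite -{1}my -mcompZ mcompK mcompZ my.
have [n an] := hcomp_sum G a.
have ge_n i : (n <= i)%N -> hcomp G i a = 0.
  move=> ni; rewrite an linear_sum big1 //= => j _.
  by rewrite hcompK gtn_eqF // (leq_trans (ltn_ord j)).
rewrite {1}an scaler_suml raddf_sum /=.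
under eq_bigr do rewrite mE (inj_eq (addIr y)).
case: z => i /=; last by rewrite scale0r big1.
have [ni|lt] := leqP n i.
  rewrite ge_n // scale0r big1 // => j _; rewrite eqz_nat gtn_eqF //.
  by rewrite (leq_trans (ltn_ord j)).
rewrite (bigD1 (Ordinal lt)) //= eqxx big1 ?addr0 // => j /eqP nj.
rewrite eqz_nat; case: eqP => // e; case: nj; exact/val_inj.
Qed.

Section HomogeneousMatrix.
Variables (m n l : nat) (a : 'I_m -> int) (b : 'I_n -> int) (c : 'I_l -> int).

Definition hmx m n (a : 'I_m -> int) (b : 'I_n -> int) (A : 'M[R]_(m, n)) :=
  forall s t, in_degz (a s - b t) (A s t).

Definition cmx m n (a : 'I_m -> int) (b : 'I_n -> int) (A : 'M[R]_(m, n)) :=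
  \matrix_(s, t) hcompz (a s - b t) (A s t).

Lemma hmx_cmx (A : 'M_(m, n)) : hmx a b (cmx a b A).
Proof. by move=> s t; rewrite mxE; apply: hcompzK. Qed.

Lemma hmxM (A : 'M_(m, n)) (B : 'M_(n, l)) : hmx a b A -> hmx b c B -> hmx a c (A *m B).
Proof.
move=> hA hB s t; rewrite mxE; apply: in_degz_sum => i.
by rewrite -(subrKA (b i)); apply: in_degzM.
Qed.

Lemma cmxM (A : 'M_(m, n)) (B : 'M_(n, l)) :
  hmx b c B -> cmx a c (A *m B) = cmx a b A *m B.
Proof.
move=> hB; apply/matrixP => s t; rewrite !mxE raddf_sum; apply: eq_bigr => i _ /=.
by rewrite mxE -(subrKA (b i)) hcompz_mul.
Qed.

Lemma cmx_id (A : 'M_(m, n)) : hmx a b A -> cmx a b A = A.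
Proof. by move=> hA; apply/matrixP => s t; rewrite mxE; apply: hA. Qed.

Lemma mx_lift (A : 'M[R]_(m, n)) (B : 'M[R]_(l, n)) :
  (forall s, exists w, row s A = w *m B) -> exists W, A = W *m B.
Proof.
move=> /fin_all_exists [w wP]; exists (\matrix_s w s).
by apply/row_matrixP => s; rewrite wP row_mul rowK.
Qed.

End HomogeneousMatrix.

Section Compare.
Variables (M : lmodType R) (MG : mod_grading M).


Definition gcyc (F : free_seq) (gen : 'I_(rk F 0) -> M) i : 'rV[R]_(rk F i) -> Prop :=
  match i with
  | 0%N => fun v => \sum_s v 0 s *: gen s = 0
  | i'.+1 => fun v => v *m diff F i' = 0
  end.

Definition aug_resolution (F : free_seq) (gen : 'I_(rk F 0) -> M) : Prop :=
  [/\ forall i, hmx (@shift F i.+1) (@shift F i) (diff F i),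
      forall i (v : 'rV[R]_(rk F i)), @gcyc F gen i v <-> exists w, v = w *m diff F i,
      forall s, mcomp MG (shift s) (gen s) = gen s &
      forall m, exists v : 'rV[R]_(rk F 0), m = \sum_s v 0 s *: gen s].

Lemma aug_resolution_ex F :
  free_resolution MG F -> exists gen, @aug_resolution F gen.
Proof. by case=> [h [ex [gen [gd gs gk]]]]; exists gen; split=> // -[|i] v; [exact: gk | exact: ex]. Qed.

Section ChainMap.
Variables (F F' : free_seq) (gen : 'I_(rk F 0) -> M) (gen' : 'I_(rk F' 0) -> M).
Hypotheses (Fr : @aug_resolution F gen) (Fr' : @aug_resolution F' gen').

Definition good i (f : 'M[R]_(rk F i, rk F' i)) : Prop :=
  hmx (@shift F i) (@shift F' i) f /\
  forall v, @gcyc F gen i v -> @gcyc F' gen' i (v *m f).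

Lemma comb_gen (v : 'rV_(rk F 0)) (f : 'M[R]_(rk F 0, rk F' 0)) :
  (forall s, gen s = \sum_t f s t *: gen' t) ->
  \sum_t (v *m f) 0 t *: gen' t = \sum_s v 0 s *: gen s.
Proof.
move=> fg; under [RHS]eq_bigr do rewrite fg scaler_sumr.
rewrite exchange_big; apply: eq_bigr => t _ /=.
by rewrite mxE scaler_suml; apply: eq_bigr => s _; rewrite scalerA.
Qed.

Lemma good0 : exists f, good (i := 0) f /\ forall s, gen s = \sum_t f s t *: gen' t.
Proof.
have [_ _ gd _] := Fr; have [_ _ gd' gs'] := Fr'.
have [v vP] := fin_all_exists (fun s => gs' (gen s)).
pose f := cmx (@shift F 0) (@shift F' 0) (\matrix_(s, t) v s 0 t).
have fP s : gen s = \sum_t f s t *: gen' t.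
  rewrite -{1}gd {1}vP raddf_sum; apply: eq_bigr => t _ /=.
  by rewrite !mxE -(mcomp_scale _ _ (gd' t)) subrK.
by exists f; split=> //; split=> [|w]; [apply: hmx_cmx | rewrite /= comb_gen].
Qed.

Lemma good_step i (f : 'M[R]_(rk F i, rk F' i)) : good f ->
  exists f', good (i := i.+1) f' /\ diff F i *m f = f' *m diff F' i.
Proof.
move=> [hf cf]; have [hd ex _ _] := Fr; have [hd' ex' _ _] := Fr'.
have [|W WP] := @mx_lift _ _ _ (diff F i *m f) (diff F' i).
  move=> s; apply/(ex' i); rewrite row_mul; apply: cf; apply/(ex i).
  by exists (delta_mx 0 s); rewrite -rowE.
have WP' : diff F i *m f = cmx (@shift F i.+1) (@shift F' i.+1) W *m diff F' i.
  by rewrite -(cmxM _ _ (hd' i)) -WP cmx_id //; apply: hmxM (hd i) hf.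
exists (cmx (@shift F i.+1) (@shift F' i.+1) W); split=> //; split.
  exact: hmx_cmx.
by move=> v /= vd; rewrite -mulmxA -WP' mulmxA vd mul0mx.
Qed.

Fixpoint chain i : {f : 'M[R]_(rk F i, rk F' i) | good f} :=
  match i with
  | 0%N => let c := constructive_indefinite_description _ good0 in
           exist _ (proj1_sig c) (proj1 (proj2_sig c))
  | i'.+1 =>
      let c := constructive_indefinite_description _
                 (good_step (proj2_sig (chain i'))) in
      exist _ (proj1_sig c) (proj1 (proj2_sig c))
  end.

Lemma chain_map : exists f : forall i, 'M[R]_(rk F i, rk F' i),
  [/\ forall i, hmx (@shift F i) (@shift F' i) (f i),
      forall i, diff F i *m f i = f i.+1 *m diff F' i &
      forall s, gen s = \sum_t f 0%N s t *: gen' t].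
Proof.
exists (fun i => proj1_sig (chain i)); split=> [i|i|] /=.
- exact: (proj2_sig (chain i)).1.
- by case: constructive_indefinite_description => f' [].
- by case: constructive_indefinite_description => f' [].
Qed.

End ChainMap.

Lemma homology_rank_le F F' gen gen' i j :
  @aug_resolution F gen -> @aug_resolution F' gen' ->
  (homology_rank F i j <= homology_rank F' i j)%N.
Proof.
move=> Fr Fr'; have [f [hf cf f0]] := chain_map Fr Fr'.
have [g [_ cg g0]] := chain_map Fr' Fr.
have [_ ex _ _] := Fr; have [_ ex' _ _] := Fr'.
have htpy n : exists (h : 'M_(rk F n, rk F n.+1)) E,
    [/\ f n *m g n - 1%:M = h *m diff F n + E,
        kcycles F n *m map_mx aug E = 0 &
        (n = 0%N /\ E = 0) \/ diff F n *m E = 0].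
  elim: n => [|n [h [E [hE _ E0]]]].
    have [|h hP] := @mx_lift _ _ _ (f 0%N *m g 0%N - 1%:M) (diff F 0).
      move=> s; apply/(ex 0%N) => /=.
      rewrite rowE mulmxBr mulmx1 mulmxA.
      have subE (u v : 'rV[R]_(rk F 0)) t : (u - v) 0 t = u 0 t - v 0 t.
        by rewrite !mxE.
      under eq_bigr do rewrite subE scalerBl.
      by rewrite sumrB (comb_gen _ g0) (comb_gen _ f0) subrr.
    by exists h, 0; rewrite addr0 map_mx0 !mulmx0; split=> //; left.
  have dE : diff F n *m E = 0 by case: E0 => [[_ ->]|//]; rewrite mulmx0.
  have dd m : diff F m.+1 *m diff F m = 0.
    apply/row_matrixP => s; rewrite row_mul row0; apply/(ex m.+1).
    by exists (delta_mx 0 s); rewrite -rowE.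
  have [|h' hP] := @mx_lift _ _ _ (f n.+1 *m g n.+1 - 1%:M - diff F n *m h) (diff F n.+1).
    move=> s; apply/(ex n.+1) => /=; rewrite -row_mul !mulmxBl -mulmxA -cg mulmxA -cf.
    rewrite mul1mx -mulmxA -[X in _ - X - _]mulmx1 -mulmxBr hE mulmxDr dE addr0.
    by rewrite mulmxA subrr row0.
  exists h', (diff F n *m h); split; first by rewrite -hP subrK.
    by rewrite map_mxM -/(kdiff F n) /= mulmxA mulmx_ker mul0mx.
  by right; rewrite mulmxA dd mul0mx.
have dd F0 gen0 m : @aug_resolution F0 gen0 -> kdiff F0 m.+1 *m kdiff F0 m = 0.
  case=> _ ex0 _ _; rewrite -map_mxM (_ : _ *m _ = 0) ?map_mx0 //.
  apply/row_matrixP => s; rewrite row_mul row0; apply/(ex0 m.+1).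
  by exists (delta_mx 0 s); rewrite -rowE.
have bd_cyc F0 gen0 m : @aug_resolution F0 gen0 -> (kdiff F0 m <= kcycles F0 m)%MS.
  by case: m => [|m] F0r /=; [apply: submx1 | apply/sub_kermxP/(dd _ _ _ F0r)].
pose kf n := map_mx aug (f n); pose kg n := map_mx aug (g n).
have kcf n : kdiff F n *m kf n = kf n.+1 *m kdiff F' n by rewrite -!map_mxM cf.
have kcg n : kdiff F' n *m kg n = kg n.+1 *m kdiff F n by rewrite -!map_mxM cg.
have kf_cyc : (kcycles F i *m kf i <= kcycles F' i)%MS.
  case: (i) => [|n] /=; first exact: submx1.
  by apply/sub_kermxP; rewrite -mulmxA -kcf mulmxA mulmx_ker mul0mx.
have kf_deg : degpart F i j *m kf i = kf i *m degpart F' i j.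
  apply/matrixP => s t; rewrite mul_diag_mx mul_mx_diag !mxE.
  have [->|st] := eqVneq (shift s) (shift t); first by rewrite mulrC.
  by rewrite (aug_in_degz (hf i s t)) ?subr_eq0 // mulr0 mul0r.
have kfg_bd : (kcycles F i *m (kf i *m kg i - 1%:M) <= kdiff F i)%MS.
  have [h [E [hE zE _]]] := htpy i.
  rewrite -map_mxM -(map_mx1 aug) -map_mxB hE map_mxD map_mxM mulmxDr zE addr0.
  by rewrite mulmxA submxMl.
rewrite /homology_rank; set Z := (kcycles F i :&: _)%MS; set B := (kdiff F i :&: _)%MS.
set Z' := (kcycles F' i :&: _)%MS; set B' := (kdiff F' i :&: _)%MS.
have BZ' : (B' <= Z')%MS by rewrite capmxS // (bd_cyc _ _ _ Fr').
have ZX : (Z *m kf i <= Z')%MS.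
  rewrite sub_capmx (submx_trans _ kf_cyc) ?submxMr ?capmxSl //=.
  apply: submx_trans (submxMr _ (capmxSr _ _)) _.
  by rewrite kf_deg submxMl.
have kerB : (Z :&: kermx (kf i *m cokermx B') <= B)%MS.
  set U := (Z :&: _)%MS.
  have UZ : (U <= Z)%MS := capmxSl _ _.
  rewrite sub_capmx (submx_trans UZ (capmxSr _ _)) andbT.
  have UB : (U *m kf i <= B')%MS.
    by rewrite submxE -mulmxA; apply/eqP/sub_kermxP/capmxSr.
  have Ug : (U *m kf i *m kg i <= kdiff F i)%MS.
    apply: submx_trans (submxMr _ (submx_trans UB (capmxSl _ _))) _.
    by rewrite kcg submxMl.
  have Uh : (U *m (kf i *m kg i - 1%:M) <= kdiff F i)%MS.
    by apply: submx_trans kfg_bd; rewrite submxMr // (submx_trans UZ) ?capmxSl.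
  rewrite -[U](subKr (U *m kf i *m kg i)) addmx_sub // eqmx_opp.
  by rewrite -[X in _ - X]mulmx1 -mulmxA -mulmxBr.
rewrite leq_subLR -(mxrank_mul_ker Z (kf i *m cokermx B')) addnC.
apply: leq_add; first exact: mxrankS.
apply: (@leq_trans (\rank (Z' *m cokermx B'))); first by rewrite mulmxA mxrankS ?submxMr.
rewrite leq_subRL ?mxrankS // -(mxrank_mul_ker Z' (cokermx B')) addnC leq_add2l.
by rewrite mxrankS // sub_capmx BZ'; apply/sub_kermxP; rewrite mulmx_coker.
Qed.

Lemma homology_rank_indep F F' i j :
  free_resolution MG F -> free_resolution MG F' ->
  homology_rank F i j = homology_rank F' i j.
Proof.
move=> /aug_resolution_ex [gen Fr] /aug_resolution_ex [gen' Fr'].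
by apply/eqP; rewrite eqn_leq (homology_rank_le _ _ Fr Fr') (homology_rank_le _ _ Fr' Fr).
Qed.

End Compare.

Definition zero_seq : free_seq :=
  @FreeSeq (fun=> 0%N) (fun _ _ => 0) (fun=> 0).

(* rank_k Tor^R_i(M, k)_j, the rank of H_i(F \otimes_R k)_j computed from a chosen graded free resolution of M;
   by homology_rank_indep the choice is immaterial. *)
Definition betti (M : lmodType R) (MG : mod_grading M) (i : nat) (j : int) : nat :=
  homology_rank (epsilon (inhabits zero_seq) (free_resolution MG)) i j.

Definition koszul (M : lmodType R) (MG : mod_grading M) : Prop :=
  (exists m : M, m != 0) /\
  (forall (i : nat) (j : int), j != i%:Z -> betti MG i j = 0%N).

End Grading.

(* R^C; w.1 and w.2 are the coordinates on u_1, ..., u_p and v_1, ..., v_q.  The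
   phantom arguments determine the action of R defined below. *)
Definition table_mod (k : fieldType) (R : comAlgType k) (G : std_grading R)
    (e : nat) (x : 'I_e -> R) (xB : is_basis (in_deg G 1) x) (p q : nat)
    (C : 'M[k]_(e * p, q)) : Type :=
  ('rV[k]_p * 'rV[k]_q)%type.

Section TableModule.
Variables (k : fieldType) (R : comAlgType k) (G : std_grading R).
Variables (e : nat) (x : 'I_e -> R) (xB : is_basis (in_deg G 1) x).

Lemma coord1_ex a : exists c : 'rV[k]_e, hcomp G 1 a == \sum_l c 0 l *: x l.
Proof.
have [|c [/eqP ? _]] := xB.2 (hcomp G 1 a); last by exists c.
by rewrite /in_deg hcompK.
Qed.

(* The coordinates on x of the degree one component. *)
Definition coord1 (a : R) : 'rV[k]_e := xchoose (coord1_ex a).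

Lemma coord1E a : hcomp G 1 a = \sum_l coord1 a 0 l *: x l.
Proof. exact/eqP/(xchooseP (coord1_ex a)). Qed.

Lemma coord1_uniq a (c : 'rV_e) :
  hcomp G 1 a = \sum_l c 0 l *: x l -> coord1 a = c.
Proof.
move=> ac; have [|d [_ dP]] := xB.2 (hcomp G 1 a); first by rewrite /in_deg hcompK.
by rewrite -(dP _ ac) -(dP _ (coord1E a)).
Qed.

Lemma coord1_is_linear : linear coord1.
Proof.
move=> c a b; apply: coord1_uniq; rewrite linearP /= !coord1E scaler_sumr.
rewrite -big_split; apply: eq_bigr => l _ /=.
by rewrite !mxE scalerDl scalerA.
Qed.

HB.instance Definition _ := GRing.isLinear.Build k R _ _ coord1 coord1_is_linear.

Lemma coord1M a b :
  coord1 (a * b) = aug G a *: coord1 b + aug G b *: coord1 a.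
Proof.
apply: coord1_uniq; rewrite hcomp_mulE big_ord_recl big_ord1 /= !augE !coord1E.
rewrite mulr_algl mulr_algr !scaler_sumr -big_split; apply: eq_bigr => l _ /=.
by rewrite !mxE scalerDl !scalerA.
Qed.

Lemma coord1_1 : coord1 1 = 0.
Proof.
apply: coord1_uniq; rewrite -(hcomp1 G) hcompK big1 // => l _.
by rewrite mxE scale0r.
Qed.

Variables p q : nat.

Section Module.
Variable C : 'M[k]_(e * p, q).

HB.instance Definition _ := GRing.Zmodule.copy (table_mod xB C) ('rV[k]_p * 'rV[k]_q)%type.

(* The matrix of multiplication by x_l, with row index (l, n) of C encoded as
   mxvec_index l n. *)
Definition table (l : 'I_e) : 'M[k]_(p, q) := \matrix_(n, h) C (mxvec_index l n) h.

Definition table_scale (a : R) (w : table_mod xB C) : table_mod xB C :=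
  (aug G a *: w.1, aug G a *: w.2 + \sum_l coord1 a 0 l *: (w.1 *m table l)).

Lemma table_scaleA a b w :
  table_scale a (table_scale b w) = table_scale (a * b) w.
Proof.
rewrite /table_scale /= rmorphM /= !scalerA; congr pair.
rewrite scalerDr scalerA -addrA; congr (_ + _).
rewrite coord1M scaler_sumr -big_split; apply: eq_bigr => l _ /=.
by rewrite !mxE -scalemxAl !scalerA scalerDl [coord1 a 0 l * _]mulrC.
Qed.

Lemma table_scale1 : left_id 1 table_scale.
Proof.
case=> u v; rewrite /table_scale /= rmorph1 !scale1r coord1_1 big1 ?addr0 // => l _.
by rewrite mxE scale0r.
Qed.

Lemma table_scaleDr : right_distributive table_scale +%R.
Proof.
move=> a [u v] [u' v']; rewrite /table_scale /=; congr pair; first exact: scalerDr.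
rewrite /= scalerDr addrACA -big_split; congr (_ + _); apply: eq_bigr => l _ /=.
by rewrite mulmxDl scalerDr.
Qed.

Lemma table_scaleDl w : {morph table_scale^~ w : a b / a + b}.
Proof.
move=> a b; rewrite /table_scale /= rmorphD /= !scalerDl; congr pair.
rewrite /= addrACA -big_split; congr (_ + _); apply: eq_bigr => l _ /=.
by rewrite linearD /= mxE scalerDl.
Qed.

HB.instance Definition _ := GRing.Zmodule_isLmodule.Build R (table_mod xB C)
  table_scaleA table_scale1 table_scaleDr table_scaleDl.

(* x_l u_n = \sum_h C_((l, n), h) v_h and x_l v_h = 0. *)
Lemma table_act l (w : table_mod xB C) :
  x l *: w = (0, \row_h \sum_n w.1 0 n * C (mxvec_index l n) h).
Proof.
have x1 : hcomp G 1 (x l) = x l := xB.1 l.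
have aug0 : aug G (x l) = 0.
  by apply: (@alg_inj _ R); rewrite /= -augE -x1 hcompK scale0r.
have coordl : coord1 (x l) = delta_mx 0 l.
  apply: coord1_uniq; rewrite x1 (bigD1 l) //= mxE !eqxx scale1r big1 ?addr0 //.
  by move=> i /negPf il; rewrite mxE il andbF scale0r.
rewrite /GRing.scale /= /table_scale aug0 !scale0r add0r coordl; congr pair.
rewrite (bigD1 l) //= mxE !eqxx scale1r big1 ?addr0 => [|i /negPf il]; last first.
  by rewrite mxE il andbF scale0r.
by apply/rowP => h; rewrite !mxE; apply: eq_bigr => n _; rewrite mxE.
Qed.

Definition table_comp (j : int) (w : table_mod xB C) : table_mod xB C :=
  (if j == 0 then w.1 else 0, if j == 1 then w.2 else 0).

Lemma table_comp_is_additive j : zmod_morphism (table_comp j).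
Proof.
move=> [u v] [u' v']; rewrite /table_comp; congr pair => /=; case: ifP => // _.
  by rewrite subr0.
by rewrite subr0.
Qed.

HB.instance Definition _ j :=
  GRing.isZmodMorphism.Build _ _ (table_comp j) (table_comp_is_additive j).

Lemma table_compK i j w :
  table_comp i (table_comp j w) = if i == j then table_comp j w else 0.
Proof.
rewrite /table_comp /=; have [<-|ij] := eqVneq i j.
  by case: (i == 0); case: (i == 1).
have sub (n : int) : i == n -> (j == n) = false.
  by move/eqP <-; rewrite eq_sym (negPf ij).
by congr pair; case: ifP => // /sub ->.
Qed.

Lemma table_comp_sum w :
  exists2 s : seq int, uniq s & w = \sum_(j <- s) table_comp j w.
Proof.
exists [:: 0; 1] => //; rewrite big_cons big_seq1 /table_comp /=.
by case: w => u v; congr pair; rewrite /= ?addr0 ?add0r.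
Qed.

Lemma table_compZ (i : nat) (j : int) a w :
  table_comp (i%:Z + j) (hcomp G i a *: table_comp j w)
  = hcomp G i a *: table_comp j w.
Proof.
have augi b : aug G (hcomp G i b) = if i == 0%N then aug G b else 0.
  apply: (@alg_inj _ R) => /=; rewrite -augE hcompK eq_sym; case: eqP => [->|].
    by rewrite augE.
  by rewrite scale0r.
have coordi b : coord1 (hcomp G i b) = if i == 1%N then coord1 b else 0.
  apply: coord1_uniq; rewrite hcompK eq_sym; case: eqP => [->|_].
    by rewrite coord1E.
  by rewrite big1 // => l _; rewrite mxE scale0r.
rewrite /GRing.scale /= /table_scale /table_comp /= augi coordi.
case: i {augi coordi} => [|[|i]] /=.
- rewrite add0r; have s0 (u : 'rV[k]_p) : \sum_l (0 : 'rV[k]_e) 0 l *: (u *m table l) = 0.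
    by rewrite big1 // => l _; rewrite mxE scale0r.
  by rewrite s0; congr pair; case: eqP; rewrite ?addr0 ?scaler0.
- rewrite !scale0r add0r; congr pair; first by rewrite if_same.
  case: (eqVneq j 0) => [->|j0]; first by rewrite addr0.
  rewrite big1 ?if_same // => l _; by rewrite mul0mx scaler0.
- rewrite !scale0r add0r big1 ?if_same // => l _; by rewrite mxE scale0r.
Qed.

Definition table_grading : mod_grading G (table_mod xB C) :=
  @ModGrading k R G (table_mod xB C) table_comp table_compK table_comp_sum table_compZ.

End Module.

Definition linear_locus (C : 'M[k]_(e * p, q)) : Prop := koszul (table_grading C).

End TableModule.

Section Zariski.
Variables (k : fieldType) (m n : nat).

(* The entries of C, in the order of mxvec, are the coordinates of the affine
   space. *)
Definition mx_eval (P : {mpoly k[m * n]}) (C : 'M[k]_(m, n)) : k :=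
  P.@[fun s => mxvec C 0 s].

Definition zariski_closed (Z : 'M[k]_(m, n) -> Prop) : Prop :=
  exists I : {mpoly k[m * n]} -> Prop,
    forall C, Z C <-> forall P, I P -> mx_eval P C = 0.

Definition zariski_open (U : 'M[k]_(m, n) -> Prop) : Prop :=
  zariski_closed (fun C => ~ U C).

Definition zariski_interior (A : 'M[k]_(m, n) -> Prop) (C : 'M[k]_(m, n)) : Prop :=
  exists U, [/\ zariski_open U, forall D, U D -> A D & U C].

End Zariski.

(* Main.v *)
From HB Require Import structures.
Require Import Defs.
From Stdlib Require Import ClassicalEpsilon.
From mathcomp Require Import all_boot all_order all_algebra.
From mathcomp.multinomials Require Import mpoly.

(** A Conca generator x forces R = R_0 + R_1 + R_2, and it makes many modules
    linear for a simple reason.  Let M = M_0 + M_1 be generated in degree zero, and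
    let N_1 in R_1 M_0 be its linear syzygies, so that its syzygy module is
    N_1 + R_2 M_0.  If x M_0 = M_1, then for b in R_1 M_0 there is m in M_0 such that
    b - x m is in N_1, and x (b - x m) = x b; hence x N_1 = R_2 M_0.  So N_1 satisfies
    the hypothesis again, and M has a linear resolution.

    To reach all the modules of the theorem and to obtain open sets, the argument
    is run for a condition that also covers extensions and in which x^2 = 0 is
    weakened.  A pair (y, z) of linear forms with y z = 0 and y R_1 = z R_1 = R_2
    replaces (x, x), and the roles of y and z alternate along the resolution.  The
    condition ([conca_filtered]) on a subspace K of R_1 V is that for some
    V' in V one has y V' in K and z K + R_2 V' = R_2 V.  The lemma
    [presentation_syzygy] shows that it passes to linear syzygies and that the
    syzygies are generated by the linear ones;
    [koszul_of_presentation] assembles the linear resolution.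

    By [linear_locus_criterion] three families of tables give Koszul modules.
    The modules M with x M = 0 (V' = M_0) exist for all q <= (e - 1) p.  Those
    with Ann(x)_1 M_0 = M_1 (V' = 0) form a set with non-empty interior when
    q <= (e - r) p, since Ann(x)_1 has dimension e - r.  Finally, for q <= e - 1 fix
    a basis element u of M_0.  A generic table has R_1 u = M_1, and
    some non-zero linear form y kills u.  As r < e, some non-zero z satisfies y z = 0.
    The vectors y and z can be chosen as polynomial functions of the table
    ([adjugate_kernel]) that take the value x at one table, so generically (y, z)
    is a pair as above, and V' = k u works.  The non-vanishing of a product of
    determinants then describes an open set of Koszul modules. *)

Set Implicit Arguments.
Unset Strict Implicit.
Unset Printing Implicit Defensive.

Section KoszulTables.
Import GRing.Theory.
Local Open Scope ring_scope.

(** * Subspaces and kernels over a field *)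

Section LinearAlgebra.
Variable k : fieldType.

Lemma subspace_row_base (N : nat) (S : 'rV[k]_N -> Prop) :
  S 0 -> (forall c u v, S u -> S v -> S (c *: u + v)) ->
  exists n (A : 'M[k]_(n, N)), row_free A /\ forall v, S v <-> (v <= A)%MS.
Proof.
move=> S0 SD.
have Ssub n (A : 'M[k]_(n, N)) : (forall i, S (row i A)) ->
    forall v, (v <= A)%MS -> S v.
  move=> SA v /submxP [c ->]; rewrite mulmx_sum_row.
  elim/big_ind: _ => [//|u w Su Sw|i _]; first by rewrite -[u]scale1r; apply: SD.
  by rewrite -[_ *: _]addr0; apply: SD.
(* An independent family in S either spans S or extends; j bounds the number of
   vectors that can still be added. *)
suff grow j n (A : 'M[k]_(n, N)) : (N <= n + j)%N -> row_free A ->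
    (forall i, S (row i A)) ->
    exists n' (A' : 'M[k]_(n', N)), row_free A' /\ forall v, S v <-> (v <= A')%MS.
  by apply: (grow N 0%N 0) => [//||[]//]; rewrite /row_free mxrank0.
elim: j n A => [|j IHj] n A leN freeA SA.
  exists n, A; split=> // v; split; last exact: Ssub.
  move=> _; apply: submx_full; rewrite /row_full eqn_leq rank_leq_col.
  by rewrite (eqP freeA) -[n]addn0.
case: (classic (exists2 v, S v & ~~ (v <= A)%MS)) => [[v Sv vA]|noext]; last first.
  exists n, A; split=> // v; split=> [Sv|]; last exact: Ssub.
  by apply/negPn/negP => vA; apply: noext; exists v.
apply: (IHj _ (col_mx v A)); first by rewrite add1n addSnnS.
  rewrite /row_free eqn_leq rank_leq_row /=.
  apply: (@leq_trans (\rank A).+1); first by rewrite (eqP freeA).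
  rewrite (ltn_leqif (mxrank_leqif_sup _)); last by rewrite -addsmxE addsmxSr.
  by apply: contra vA; apply: submx_trans; rewrite -addsmxE addsmxSl.
move=> i; case: (splitP i) => [i0|i0] ei.
  suff -> : i = lshift n i0 by rewrite rowKu row_id.
  exact/val_inj.
by suff -> : i = rshift 1 i0; [rewrite rowKd | apply/val_inj].
Qed.

Lemma row_free_in_kermx (q N N' : nat) (A : 'M[k]_(N, N')) :
  (q + N' <= N)%N -> exists H : 'M[k]_(q, N), row_free H /\ H *m A = 0.
Proof.
move=> leN; exists (pid_mx q *m row_base (kermx A)).
have le_q : (q <= \rank (kermx A))%N.
  rewrite mxrank_ker leq_subRL ?rank_leq_row // addnC.
  by apply: leq_trans leN; rewrite leq_add2l rank_leq_col.
split; last first.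
  by apply/sub_kermxP; rewrite (submx_trans (submxMl _ _)) // eq_row_base.
by rewrite /row_free mxrankMfree ?row_base_free // rank_pid_mx.
Qed.

(** A vector in the left kernel of F that depends polynomially on F and takes a
    prescribed value at one matrix F0 of full column rank.  The columns of F0 are
    completed by constant ones, collected in D, to an invertible matrix.  For
    every F the identity adj(A) A = det(A) I, with A = F J + D, says that
    w adj(A) A is a multiple of w, and w vanishes on the columns that come from F. *)
Lemma adjugate_kernel (e n : nat) (F0 : 'M[k]_(e, n)) (x : 'rV[k]_e) :
  row_full F0 -> x *m F0 = 0 ->
  exists (J : 'M[k]_(n, e)) (D : 'M[k]_e) (w : 'rV[k]_e),
  [/\ F0 *m J + D \in unitmx,
      w *m \adj (F0 *m J + D) = x,
      forall F, w *m \adj (F *m J + D) *m F = 0 &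
      forall F, F *m J + D \in unitmx -> row_full F].
Proof.
move=> fullF xF; have le_n : (n <= e)%N by rewrite -(eqP fullF) rank_leq_row.
pose L := col_ebase F0; pose U := row_ebase F0.
have F0E : L *m pid_mx n *m U = F0 by have := mulmx_ebase F0; rewrite (eqP fullF).
have uL : L \in unitmx := col_ebase_unit F0.
have uU : U \in unitmx := row_ebase_unit F0.
(* J' is a right inverse of J that kills D, so that multiplying A = F J + D by J'
   extracts F. *)
pose J : 'M[k]_(n, e) := invmx U *m pid_mx n.
pose J' : 'M[k]_(e, n) := pid_mx n *m U.
pose D := L *m copid_mx n.
have JJ' : J *m J' = 1%:M.
  by rewrite /J /J' mulmxA -[_ *m pid_mx n *m pid_mx n]mulmxA pid_mx_id // pid_mx_1
    mulmx1 mulVmx.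
have DJ' : D *m J' = 0.
  by rewrite /D /J' mulmxA -[_ *m _ *m pid_mx n]mulmxA mul_copid_mx_pid // mulmx0 mul0mx.
have A0E : F0 *m J + D = L.
  rewrite -F0E /J /D mulmxA -[_ *m U *m _]mulmxA mulmxV // mulmx1 -mulmxA.
  by rewrite pid_mx_id // /copid_mx mulmxBr mulmx1 addrC subrK.
exists J, D, ((\det L)^-1 *: (x *m L)); rewrite A0E; split=> // [|F|F uA].
- rewrite -scalemxAl -mulmxA mul_mx_adj mul_mx_scalar scalerA mulVf ?scale1r //.
  by rewrite -unitfE -unitmxE.
- set A := F *m J + D; set y := _ *m \adj A.
  have FE : A *m J' = F by rewrite mulmxDl DJ' addr0 -mulmxA JJ' mulmx1.
  have yA : y *m A = \det A *: ((\det L)^-1 *: (x *m L)).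
    by rewrite /y -mulmxA mul_adj_mx mul_mx_scalar.
  have xLJ' : x *m L *m J' = 0 by rewrite /J' -mulmxA [L *m _]mulmxA F0E.
  by rewrite -[X in y *m X]FE mulmxA yA -!scalemxAl xLJ' !scaler0.
apply/row_fullP; exists (J *m invmx (F *m J + D)).
have FE : (F *m J + D) *m J' = F by rewrite mulmxDl DJ' addr0 -mulmxA JJ' mulmx1.
by rewrite -{2}FE mulmxA mulmxKV.
Qed.

End LinearAlgebra.

(** * Polynomial functions of a matrix *)

Section PolynomialFunctions.
Variables (k : fieldType) (m n : nat).

Definition polyfun (g : 'M[k]_(m, n) -> k) : Prop :=
  exists P : {mpoly k[m * n]}, forall C, g C = mx_eval P C.

Definition polymap a b (g : 'M[k]_(m, n) -> 'M[k]_(a, b)) : Prop :=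
  forall i j, polyfun (fun C => g C i j).

Lemma polyfun_ext g g' : g =1 g' -> polyfun g -> polyfun g'.
Proof. by move=> gg' [P PE]; exists P => C; rewrite -gg'. Qed.

Lemma polyfun_const c : polyfun (fun=> c).
Proof. by exists c%:MP => C; rewrite /mx_eval mevalC. Qed.

Lemma polyfun_entry i j : polyfun (fun C => C i j).
Proof. by exists 'X_(mxvec_index i j) => C; rewrite /mx_eval mevalXU mxvecE. Qed.

Lemma polyfunD g h : polyfun g -> polyfun h -> polyfun (fun C => g C + h C).
Proof.
by move=> [P PE] [Q QE]; exists (P + Q) => C; rewrite PE QE /mx_eval mevalD.
Qed.

Lemma polyfunM g h : polyfun g -> polyfun h -> polyfun (fun C => g C * h C).
Proof.
by move=> [P PE] [Q QE]; exists (P * Q) => C; rewrite PE QE /mx_eval mevalM.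
Qed.

Lemma polyfun_sum (I : Type) (s : seq I) (P : pred I) (g : I -> _ -> k) :
  (forall i, polyfun (g i)) -> polyfun (fun C => \sum_(i <- s | P i) g i C).
Proof.
move=> gP; elim: s => [|i s IH].
  by apply: polyfun_ext (polyfun_const 0) => C; rewrite big_nil.
apply: (@polyfun_ext (fun C => (if P i then g i C else 0) + \sum_(i <- s | P i) g i C)).
  by move=> C; rewrite big_cons; case: ifP => // _; rewrite add0r.
by apply: polyfunD => //; case: (P i) => //; apply: polyfun_const.
Qed.

Lemma polyfun_prod (I : Type) (s : seq I) (g : I -> _ -> k) :
  (forall i, polyfun (g i)) -> polyfun (fun C => \prod_(i <- s) g i C).
Proof.
move=> gP; elim: s => [|i s IH].
  by apply: polyfun_ext (polyfun_const 1) => C; rewrite big_nil.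
by apply: polyfun_ext (polyfunM (gP i) IH) => C; rewrite big_cons.
Qed.

Lemma polymap_const a b (A : 'M[k]_(a, b)) : polymap (fun=> A).
Proof. by move=> i j; apply: polyfun_const. Qed.

Lemma polymapD a b (g h : _ -> 'M[k]_(a, b)) :
  polymap g -> polymap h -> polymap (fun C => g C + h C).
Proof.
move=> gP hP i j; apply: polyfun_ext (polyfunD (gP i j) (hP i j)) => C.
by rewrite mxE.
Qed.

Lemma polymapM a b c (g : _ -> 'M[k]_(a, b)) (h : _ -> 'M[k]_(b, c)) :
  polymap g -> polymap h -> polymap (fun C => g C *m h C).
Proof.
move=> gP hP i j; apply: (@polyfun_ext (fun C => \sum_l g C i l * h C l j)).
  by move=> C; rewrite mxE.
by apply: polyfun_sum => l; apply: polyfunM.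
Qed.

Lemma polyfun_det a (g : _ -> 'M[k]_a) : polymap g -> polyfun (fun C => \det (g C)).
Proof.
move=> gP; apply: polyfun_sum => s; apply: polyfunM; first exact: polyfun_const.
by apply: polyfun_prod => i; apply: gP.
Qed.

Lemma polymap_adj a (g : _ -> 'M[k]_a) : polymap g -> polymap (fun C => \adj (g C)).
Proof.
move=> gP i j; apply: (@polyfun_ext (fun C => (-1) ^+ (j + i) * \det (row' j (col' i (g C))))).
  by move=> C; rewrite mxE.
apply: polyfunM; first exact: polyfun_const.
by apply: polyfun_det => s t; apply: polyfun_ext (gP _ _) => C; rewrite !mxE.
Qed.

Lemma interior_of_polyfun (f : 'M[k]_(m, n) -> k) (P : 'M[k]_(m, n) -> Prop) C0 :
  polyfun f -> (forall C, f C != 0 -> P C) -> f C0 != 0 -> zariski_interior P C0.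
Proof.
move=> [Q QE] fP f0; exists (fun C => f C != 0); split=> //.
exists (eq Q) => C; rewrite QE; split=> [/negP/negPn/eqP Q0 _ <- //|/(_ Q erefl) ->].
by rewrite eqxx.
Qed.

End PolynomialFunctions.

(** * Rings with a Conca generator *)

Section ConcaRing.
Variables (k : fieldType) (R : comAlgType k) (G : std_grading R).
Variable z0 : R.
Hypothesis z0P : conca_generator G z0.

(* Homogeneous components and the inclusion of k in R, entrywise. *)
Local Notation hc i := (map_mx (hcomp G i)).
Local Notation "c ^A" := (map_mx (in_alg R) c) (at level 2, format "c ^A").

Lemma in_degM i j a b : in_deg G i a -> in_deg G j b -> in_deg G (i + j) (a * b).
Proof. by rewrite /in_deg => <- <-; rewrite hcompM. Qed.

Lemma in_deg_hcomp i a : in_deg G i (hcomp G i a).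
Proof. by rewrite /in_deg hcompK eqxx. Qed.

Lemma hcomp_in_deg i j a : in_deg G j a -> i != j -> hcomp G i a = 0.
Proof. by rewrite /in_deg => <- /negPf ij; rewrite hcompK ij. Qed.

Lemma deg2_conca a : in_deg G 2 a -> exists2 b, in_deg G 1 b & a = z0 * b.
Proof. by have [_ _ + _] := z0P => /[apply]. Qed.

(** Since R_2 = z0 R_1 and R_1 R_1 = R_2, one has R_1 R_2 = z0 R_2 = z0^2 R_1 = 0. *)
Lemma mul_deg12 a b : in_deg G 1 a -> in_deg G 2 b -> a * b = 0.
Proof.
have [_ _ _ sq0] := z0P.
move=> a1 /deg2_conca [c c1 ->].
have [c' _ ac] := deg2_conca (in_degM a1 c1).
by rewrite mulrCA ac mulrA -expr2 sq0 mul0r.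
Qed.

Lemma mul_deg22 a b : in_deg G 2 a -> in_deg G 2 b -> a * b = 0.
Proof.
by move=> /deg2_conca [c c1 ->] b2; rewrite -mulrA (mul_deg12 c1 b2) mulr0.
Qed.

(** The elements without components of degree at least three form a subalgebra,
    as R_1 R_2 = R_2 R_2 = 0, and it contains the algebra generators. *)
Lemma hcomp_ge3 n a : (2 < n)%N -> hcomp G n a = 0.
Proof.
pose T (b : R) := forall i, (2 < i)%N -> hcomp G i b = 0.
have T1 : T 1 by move=> i i2; rewrite (@hcomp_in_deg i 0) //; [exact: hcomp1 | case: i i2].
have TM b c : T b -> T c -> T (b * c).
  move=> Tb Tc i i2; rewrite hcomp_mulE big1 // => j _.
  have hB := in_deg_hcomp; have : (i = j + (i - j))%N by rewrite subnKC // -ltnS.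
  move: (i - j)%N => l; have [/Tb-> _|] := ltnP 2 j; first by rewrite mul0r.
  have [/Tc-> _ _|] := ltnP 2 l; first by rewrite mulr0.
  case: (j : nat) l => [|[|[|//]]] [|[|[|//]]] // _ _ ei; rewrite ?ei // in i2.
  - exact: mul_deg12.
  - by rewrite mulrC; apply: mul_deg12.
  - exact: mul_deg22.
have [m [g [g1 /(_ a) [P ->]]]] := std_generated G.
suff: T (mmap (in_alg R) g P) by move=> + n2; apply.
rewrite /mmap; apply: (big_ind T) => [i _|b c Tb Tc i i2|u _].
- exact: linear0.
- by rewrite linearD /= Tb ?Tc ?addr0.
apply: (TM) => [i i2|].
  by rewrite /= linearZ /= T1 // scaler0.
rewrite /mmap1; apply: (big_ind T) => // s _; elim: (u s) => [|j IH]; first by rewrite expr0.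
rewrite exprS; apply: (TM) => // i i2; apply: (hcomp_in_deg (g1 s)).
by case: i i2 => [|[]].
Qed.

Lemma hcomp_decomp a : a = hcomp G 0 a + hcomp G 1 a + hcomp G 2 a.
Proof.
have [m [m3 am]] := hcomp_split G a 3; rewrite {1}am.
rewrite -(subnKC m3) big_split_ord /= [X in _ + X]big1 ?addr0.
  by rewrite !big_ord_recl big_ord0 addr0 addrA.
by move=> i _; rewrite hcomp_ge3.
Qed.

Lemma hcomp_mul1 i a b : in_deg G 1 b -> hcomp G i.+1 (a * b) = hcomp G i a * b.
Proof.
by move=> b1; have := @hcompz_mul _ _ G (Posz i) (Posz 1) a b b1; rewrite -PoszD addn1.
Qed.

Lemma hcomp_mul1_0 a b : in_deg G 1 b -> hcomp G 0 (a * b) = 0.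
Proof.
move=> b1; rewrite hcomp_mulE big_ord1 subnn -[X in _ * hcomp _ _ X]b1 hcompK.
by rewrite mulr0.
Qed.

Definition mxdeg i m n (A : 'M[R]_(m, n)) := hc i A = A.

Lemma mxdegP i m n (A : 'M[R]_(m, n)) :
  mxdeg i A <-> forall s t, in_deg G i (A s t).
Proof.
split=> [AE s t|h]; last by apply/matrixP => s t; rewrite mxE; apply: h.
by rewrite /in_deg -[in RHS]AE mxE.
Qed.

Lemma mxdegM i j m n l (A : 'M[R]_(m, n)) (B : 'M[R]_(n, l)) :
  mxdeg i A -> mxdeg j B -> mxdeg (i + j) (A *m B).
Proof.
move=> /mxdegP hA /mxdegP hB; apply/mxdegP => s t; rewrite mxE /in_deg linear_sum.
by apply: eq_bigr => u _; apply: in_degM.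
Qed.

Lemma mxdeg_lift m n (c : 'M[k]_(m, n)) : mxdeg 0 (c^A).
Proof. by apply/mxdegP => s t; rewrite mxE /= /in_deg linearZ /= hcomp1. Qed.

Lemma mxdegZ i j m n y (A : 'M[R]_(m, n)) :
  in_deg G i y -> mxdeg j A -> mxdeg (i + j) (y *: A).
Proof.
by move=> y1 /mxdegP hA; apply/mxdegP => s t; rewrite mxE; apply: in_degM.
Qed.

Lemma mxdegD i m n (A B : 'M[R]_(m, n)) : mxdeg i A -> mxdeg i B -> mxdeg i (A + B).
Proof. by rewrite /mxdeg map_mxD => -> ->. Qed.

Lemma mxdegN i m n (A : 'M[R]_(m, n)) : mxdeg i A -> mxdeg i (- A).
Proof. by rewrite /mxdeg map_mxN => ->. Qed.

Lemma hc_mul1 i m n l (A : 'M[R]_(m, n)) (B : 'M[R]_(n, l)) :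
  mxdeg 1 B -> hc i.+1 (A *m B) = hc i A *m B.
Proof.
move=> /mxdegP hB; apply/matrixP => s t; rewrite !mxE linear_sum.
by apply: eq_bigr => u _; rewrite mxE hcomp_mul1.
Qed.

Lemma hc_mul1_0 m n l (A : 'M[R]_(m, n)) (B : 'M[R]_(n, l)) :
  mxdeg 1 B -> hc 0 (A *m B) = 0.
Proof.
move=> /mxdegP hB; apply/matrixP => s t; rewrite !mxE linear_sum big1 // => u _.
exact: hcomp_mul1_0.
Qed.

Lemma mul_mxdeg21 m n l (A : 'M[R]_(m, n)) (B : 'M[R]_(n, l)) :
  mxdeg 2 A -> mxdeg 1 B -> A *m B = 0.
Proof.
move=> /mxdegP hA /mxdegP hB; apply/matrixP => s t; rewrite !mxE big1 // => u _.
by rewrite mulrC; apply: mul_deg12.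
Qed.

Lemma mxdeg_decomp m n (A : 'M[R]_(m, n)) : A = hc 0 A + hc 1 A + hc 2 A.
Proof. by apply/matrixP => s t; rewrite !mxE -hcomp_decomp. Qed.

Lemma mxdeg_hc i m n (A : 'M[R]_(m, n)) : mxdeg i (hc i A).
Proof. by apply/mxdegP => s t; rewrite mxE; apply: in_deg_hcomp. Qed.

Lemma hc_lift m n (A : 'M[R]_(m, n)) : hc 0 A = (map_mx (aug G) A)^A.
Proof. by apply/matrixP => s t; rewrite !mxE augE. Qed.

Variables (e : nat) (x : 'I_e -> R) (hx : is_basis (in_deg G 1) x).

(** * Linear resolutions *)

Definition lin_form_row n (A : 'M[k]_(e, n)) : 'rV[R]_n := (\row_l x l) *m A^A.

Definition coef_mx n (v : 'rV[R]_n) : 'M[k]_(e, n) :=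
  \matrix_(l, s) coord1 hx (v 0 s) 0 l.

Lemma lin_form_rowE n (A : 'M[k]_(e, n)) s :
  lin_form_row A 0 s = \sum_l A l s *: x l.
Proof.
rewrite mxE; apply: eq_bigr => l _.
by rewrite !mxE /= mulr_algr.
Qed.

Lemma lin_form_row_deg n (A : 'M[k]_(e, n)) : mxdeg 1 (lin_form_row A).
Proof.
apply/mxdegP => i s; rewrite ord1 lin_form_rowE /in_deg linear_sum.
by apply: eq_bigr => l _; rewrite linearZ /= hx.1.
Qed.

Lemma coef_mxK n (v : 'rV[R]_n) : mxdeg 1 v -> lin_form_row (coef_mx v) = v.
Proof.
move=> /mxdegP v1; apply/rowP => s; rewrite lin_form_rowE -[RHS]v1 (coord1E hx).
by apply: eq_bigr => l _; rewrite mxE.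
Qed.

Lemma lin_form_rowK n (A : 'M[k]_(e, n)) : coef_mx (lin_form_row A) = A.
Proof.
apply/matrixP => l s; rewrite mxE.
suff -> : coord1 hx (lin_form_row A 0 s) = \row_i A i s by rewrite mxE.
apply: coord1_uniq; have /mxdegP -> := lin_form_row_deg A.
by rewrite lin_form_rowE; apply: eq_bigr => i _; rewrite mxE.
Qed.

Definition lin_subspace n (K : 'rV[R]_n -> Prop) : Prop :=
  [/\ forall v, K v -> mxdeg 1 v, K 0 &
      forall c u v, K u -> K v -> K (c%:A *: u + v)].

Definition kspan n m (d : 'M[R]_(n, m)) (v : 'rV[R]_m) : Prop :=
  exists c : 'rV[k]_n, v = c^A *m d.

Lemma lin_subspace_basis m (K : 'rV[R]_m -> Prop) : lin_subspace K ->
  exists n (d : 'M[R]_(n, m)), [/\ mxdeg 1 d,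
    forall c : 'rV[k]_n, c^A *m d = 0 -> c = 0 &
    forall v, K v <-> kspan d v].
Proof.
case=> K1 K0 KD.
have rowD c (A B : 'M[k]_(e, m)) :
    lin_form_row (c *: A + B) = c%:A *: lin_form_row A + lin_form_row B.
  by rewrite /lin_form_row map_mxD map_mxZ mulmxDr -scalemxAr.
have [||n [A [freeA AP]]] :=
    @subspace_row_base k (e * m) (fun c => K (lin_form_row (vec_mx c))).
- by rewrite linear0 /lin_form_row map_mx0 mulmx0.
- by move=> c u v Ku Kv; rewrite linearP rowD; apply: KD.
pose d : 'M[R]_(n, m) := \matrix_t lin_form_row (vec_mx (row t A)).
have dE c : c^A *m d = lin_form_row (vec_mx (c *m A)).
  rewrite mulmx_sum_row mulmx_sum_row [vec_mx _]linear_sum /lin_form_row.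
  rewrite map_mx_sum mulmx_sumr; apply: eq_bigr => t _.
  by rewrite !rowK linearZ map_mxZ -scalemxAr !mxE.
exists n, d; split=> [|c|v].
- apply/mxdegP => t s; rewrite mxE.
  by have /mxdegP := lin_form_row_deg (vec_mx (row t A)).
- rewrite dE => /(congr1 (@coef_mx _)); rewrite lin_form_rowK.
  have -> : coef_mx (0 : 'rV[R]_m) = 0.
    by apply/matrixP => l s; rewrite !mxE linear0 mxE.
  move=> /(congr1 mxvec); rewrite vec_mxK linear0 => cA.
  by apply: (row_free_inj freeA); rewrite cA mul0mx.
split=> [Kv|[c ->]]; last by rewrite dE; apply/AP; apply: submxMl.
have /AP /submxP [c cE] : K (lin_form_row (vec_mx (mxvec (coef_mx v)))).
  by rewrite mxvecK coef_mxK //; apply: K1.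
by exists c; rewrite dE -cE mxvecK coef_mxK //; apply: K1.
Qed.

(** A two-sided version of a Conca generator x, which gives the pair (x, x).  The
    equation x^2 = 0 is lost under perturbations of x, whereas (x, x) belongs to a
    family of pairs (y, z) in which y is a generic linear form. *)
Definition conca_pair (y z : R) : Prop :=
  [/\ in_deg G 1 y, in_deg G 1 z, y * z = 0,
      forall a, in_deg G 2 a -> exists2 b, in_deg G 1 b & a = y * b &
      forall a, in_deg G 2 a -> exists2 b, in_deg G 1 b & a = z * b].

Lemma conca_pair_sym y z : conca_pair y z -> conca_pair z y.
Proof. by case=> *; split=> //; rewrite mulrC. Qed.

Lemma conca_pair_diag : conca_pair z0 z0.
Proof. by have [_ ? h sq0] := z0P; split=> // a /h. Qed.

(** With V = k^n and V' the span of the rows of B, this says that K, contained in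
    R_1 V, contains y V' and satisfies z K + R_2 V' = R_2 V.  Since R_2 V' = R_1 y V',
    the submodule N generated by K has all of R_2 V as its part of degree two, and
    it contains N' = R y V', a sum of copies of the ideal y R, such that z maps the
    degree one part of N / N' onto its degree two part.  The condition is
    inherited, with y and z exchanged, by the linear syzygies of K. *)
Definition conca_filtered n (K : 'rV[R]_n -> Prop) : Prop :=
  exists (y z : R) (s : nat) (B : 'M[k]_(s, n)),
  [/\ conca_pair y z, forall t, K (y *: row t B^A) &
      forall b, mxdeg 2 b -> exists v (a : 'rV[R]_s),
        [/\ K v, mxdeg 2 a & b = z *: v + a *m B^A]].

(** The second condition makes the rows of d minimal generators of degree one of
    their R-span. *)
Definition conca_presentation n m (d : 'M[R]_(n, m)) : Prop :=
  [/\ mxdeg 1 d, forall c : 'rV[k]_n, c^A *m d = 0 -> c = 0 &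
      conca_filtered (kspan d)].

Lemma mxdeg2_lift y m n (b : 'M[R]_(m, n)) :
  (forall a, in_deg G 2 a -> exists2 b, in_deg G 1 b & a = y * b) ->
  mxdeg 2 b -> exists2 b' : 'M[R]_(m, n), mxdeg 1 b' & b = y *: b'.
Proof.
move=> yP /mxdegP b2.
have /fin_all_exists [f fP] (st : 'I_m * 'I_n) :
    exists c, in_deg G 1 c /\ b st.1 st.2 = y * c.
  by have [c c1 cE] := yP _ (b2 st.1 st.2); exists c.
exists (\matrix_(s, t) f (s, t)).
  by apply/mxdegP => s t; rewrite mxE; have [] := fP (s, t).
by apply/matrixP => s t; rewrite !mxE; have [_ <-] := fP (s, t).
Qed.

Lemma kspan_rows n m s y (d : 'M[R]_(n, m)) (B : 'M[k]_(s, m)) :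
  (forall t, kspan d (y *: row t B^A)) ->
  exists C : 'M[k]_(s, n), y *: B^A = C^A *m d.
Proof.
move=> /fin_all_exists [c cP]; exists (\matrix_t c t).
apply/row_matrixP => t; rewrite row_mul -map_row rowK -cP.
by apply/rowP => i; rewrite !mxE.
Qed.

(** In degree one only constant combinations of the rows matter; in degree two
    every vector is reached: z K and R_2 V' are, the latter because
    R_2 V' = R_1 y V'. *)
Lemma presentation_image n m (d : 'M[R]_(n, m)) : conca_presentation d ->
  forall v, (exists w, v = w *m d) <-> (hc 0 v = 0 /\ kspan d (hc 1 v)).
Proof.
case=> d1 _ [y [z [s [B [yz yB zP]]]]] v; split=> [[w ->]|[v0 [c v1]]].
  by rewrite (hc_mul1_0 _ d1) (hc_mul1 _ _ d1) hc_lift; split=> //; eexists.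
have [C CE] := kspan_rows yB.
have [v' [a [[c' c'E] a2 v2]]] := zP _ (mxdeg_hc 2 v).
have [_ _ _ yP _] := yz.
have [a' _ aE] := mxdeg2_lift yP a2.
exists (c^A + z *: c'^A + a' *m C^A).
rewrite {1}(mxdeg_decomp v) v0 add0r v1 v2 c'E !mulmxDl -mulmxA -CE addrA.
by rewrite -scalemxAl -scalemxAr [y *: (_ *m _)]scalemxAl -aE.
Qed.

Lemma presentation_of_subspace m (K : 'rV[R]_m -> Prop) :
  lin_subspace K -> conca_filtered K ->
  exists n (d : 'M[R]_(n, m)), conca_presentation d /\
    forall v, (exists w, v = w *m d) <-> (hc 0 v = 0 /\ K (hc 1 v)).
Proof.
move=> linK [y [z [s [B [yz yB zP]]]]].
have [n [d [d1 dfree dP]]] := lin_subspace_basis linK.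
have pd : conca_presentation d.
  split=> //; exists y, z, s, B; split=> // [t|b b2]; first exact/dP.
  by have [v [a [/dP Kv a2 bE]]] := zP b b2; exists v, a.
exists n, d; split=> // v; rewrite (presentation_image pd).
by split=> -[? /dP].
Qed.

(** The step of the resolution.  By minimality and R_3 = 0, the syzygies of d are
    its linear ones, which form a subspace K, together with everything of degree
    two.  If C expresses y B through the rows of d, then z C lies in K because
    y z = 0.  To write b = y b' of degree two as an element of y K + R_2 C, compare
    b' d with the hypothesis on d: b' d = z c d + a B = z c d + a' C d
    when a = y a', so b' - z c - a' C is in K, and y times it is b - a C. *)
Lemma presentation_syzygy n m (d : 'M[R]_(n, m)) : conca_presentation d ->
  exists n' (d' : 'M[R]_(n', n)), conca_presentation d' /\
    forall v : 'rV[R]_n, v *m d = 0 <-> exists w, v = w *m d'.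
Proof.
case=> d1 dfree [y [z [s [B [yz yB zP]]]]].
have [C CE] := kspan_rows yB.
have [y1 z1 yz0 yP zPR] := yz.
pose K (v : 'rV[R]_n) := mxdeg 1 v /\ v *m d = 0.
have linK : lin_subspace K.
  split=> [v []//||c u v [u1 ud] [v1 vd]].
    by split; [apply: map_mx0 | rewrite mul0mx].
  split; last by rewrite mulmxDl -scalemxAl ud vd scaler0 addr0.
  apply: mxdegD => //; apply: (@mxdegZ 0 1) => //.
  by apply/hcomp_base; exists c.
have filtK : conca_filtered K.
  exists z, y, s, C; split=> [|t|b b2]; first exact: conca_pair_sym.
    have CtE : row t C^A *m d = y *: row t B^A.
      by rewrite -row_mul -CE; apply/rowP => i; rewrite !mxE.
    split; first by rewrite -map_row; apply: (@mxdegZ 1 0) => //; apply: mxdeg_lift.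
    by rewrite -scalemxAl CtE scalerA mulrC yz0 scale0r.
  have [b' b'1 bE] := mxdeg2_lift yP b2.
  have [v [a [[c cE] a2 bdE]]] := zP _ (mxdegM b'1 d1).
  have [a' a'1 aE] := mxdeg2_lift yP a2.
  exists (b' - z *: c^A - a' *m C^A), a; split=> //; last first.
    rewrite !scalerBr scalerA yz0 scale0r subr0 -bE scalemxAl -aE subrK //.
  split; last first.
    rewrite !mulmxBl bdE cE -scalemxAl -mulmxA -CE -scalemxAr
      [y *: (_ *m _)]scalemxAl -aE.
    by rewrite addrAC addrK subrr.
  apply: mxdegD; [apply: mxdegD => // |]; apply: mxdegN.
    by apply: (@mxdegZ 1 0) => //; apply: mxdeg_lift.
  by apply: (@mxdegM 1 0) => //; apply: mxdeg_lift.
have [n' [d' [pd' d'P]]] := presentation_of_subspace linK filtK.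
exists n', d'; split=> // v; rewrite d'P.
split=> [vd|[v0 [_ v1d]]]; last first.
  by rewrite (mxdeg_decomp v) v0 add0r mulmxDl v1d add0r
    mul_mxdeg21 //; apply: mxdeg_hc.
split; last by split; [apply: mxdeg_hc | rewrite -(hc_mul1 _ _ d1) vd map_mx0].
move: (hc_mul1 0 v d1); rewrite vd map_mx0 hc_lift => /esym /dfree ->.
by rewrite map_mx0.
Qed.

(** Packed with their sizes so that the resolution can be built by recursion: the
    number of columns of [next_pres P] is convertible to the number of rows of P,
    hence consecutive matrices are composable without a cast. *)
Record presentation := Presentation {
  pres_rows : nat;
  pres_cols : nat;
  pres_mx : 'M[R]_(pres_rows, pres_cols);
  pres_conca : conca_presentation pres_mx
}.

Lemma next_ex (P : presentation) : exists n (d : 'M[R]_(n, pres_rows P)),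
  conca_presentation d /\ forall v : 'rV[R]__, v *m pres_mx P = 0 <-> exists w, v = w *m d.
Proof. exact: presentation_syzygy (pres_conca P). Qed.

Definition next_pres (P : presentation) : presentation :=
  let c := constructive_indefinite_description _ (next_ex P) in
  let c' := constructive_indefinite_description _ (proj2_sig c) in
  Presentation (proj1 (proj2_sig c')).

Lemma next_presP (P : presentation) v :
  v *m pres_mx P = 0 <->
  exists w : 'rV[R]_(pres_rows (next_pres P)), v = w *m (pres_mx (next_pres P) : 'M_(_, pres_rows P)).
Proof.
rewrite /next_pres /=; case: constructive_indefinite_description => n h /=.
by case: constructive_indefinite_description => d [pd dP] /=.
Qed.

(** Iterating the syzygies gives a resolution whose i-th free module is generated
    in degree i, so nothing of another degree survives in Tor_i. *)
Lemma koszul_of_presentation (M : lmodType R) (MG : mod_grading G M)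
    p n (gen : 'I_p -> M) (d : 'M[R]_(n, p)) :
  (exists m : M, m != 0) ->
  (forall s, mcomp MG 0 (gen s) = gen s) ->
  (forall m, exists v : 'rV[R]_p, m = \sum_s v 0 s *: gen s) ->
  conca_presentation d ->
  (forall v : 'rV[R]_p, \sum_s v 0 s *: gen s = 0 <-> exists w, v = w *m d) ->
  koszul MG.
Proof.
move=> Mn0 gen0 genP pd dP.
pose st := nat_rect (fun=> presentation) (Presentation pd) (fun=> next_pres).
pose F : free_seq R := @FreeSeq k R (fun i => pres_cols (st i)) (fun i _ => i%:Z)
  (fun i => pres_mx (st i)).
have FP : free_resolution MG F.
  split=> [i s t|].
    rewrite /= /in_degz /= -addn1 PoszD addrAC subrr add0r.
    have [/mxdegP dd _ _] := pres_conca (st i); exact: dd.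
  split=> [i v|]; first exact: (next_presP (P := st i)).
  by exists gen; split.
split=> // i j ji.
have Fr : free_resolution MG (epsilon (inhabits (zero_seq R)) (free_resolution MG)).
  by apply: epsilon_spec; exists F.
rewrite /betti (homology_rank_indep i j Fr FP) /homology_rank.
have -> : degpart F i j = 0.
  apply/matrixP => s t; rewrite !mxE /= eq_sym (negPf ji).
  by rewrite mul0rn.
by rewrite capmx0 mxrank0.
Qed.

(** * Modules defined by multiplication tables *)

Definition lin_form (c : 'rV[k]_e) : R := \sum_l c 0 l *: x l.

Lemma lin_form_deg c : in_deg G 1 (lin_form c).
Proof.
by rewrite /in_deg linear_sum; apply: eq_bigr => l _; rewrite linearZ /= hx.1.
Qed.

Lemma coord1K a : in_deg G 1 a -> lin_form (coord1 hx a) = a.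
Proof. by rewrite /lin_form -(coord1E hx). Qed.

Lemma lin_formK c : coord1 hx (lin_form c) = c.
Proof. exact/coord1_uniq/lin_form_deg. Qed.

Lemma coef_mxD p (u v : 'rV[R]_p) : coef_mx (u + v) = coef_mx u + coef_mx v.
Proof. by apply/matrixP => l s; rewrite !mxE linearD mxE. Qed.

Lemma coef_mx_hc p (v : 'rV[R]_p) : coef_mx (hc 1 v) = coef_mx v.
Proof.
apply/matrixP => l s; rewrite !mxE; congr ((_ : 'M__) _ _); apply: coord1_uniq.
by rewrite hcompK eqxx (coord1E hx).
Qed.

Lemma coef_mx_lift p (c : 'rV[k]_p) : coef_mx (c^A) = 0.
Proof.
by apply/matrixP => l s; rewrite !mxE /= linearZ /= coord1_1 scaler0 mxE.
Qed.

Lemma coef_mxZ_lift p y (c : 'rV[k]_p) :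
  coef_mx (y *: c^A) = (coord1 hx y)^T *m c.
Proof.
apply/matrixP => l s; rewrite !mxE big_ord1 !mxE /= mulr_algr linearZ mxE.
by rewrite mulrC.
Qed.

Lemma mxvec_mulE p q (A : 'M[k]_(e, p)) (C : 'M[k]_(e * p, q)) h :
  (mxvec A *m C) 0 h = \sum_l \sum_s A l s * C (mxvec_index l s) h.
Proof.
rewrite mxE (reindex _ (curry_mxvec_bij _ _)) /= pair_bigA /=.
by apply: eq_bigr => -[l s] _; rewrite mxvecE.
Qed.

Lemma aug_alg (c : k) : aug G (c%:A) = c.
Proof. by apply: (@alg_inj _ R); rewrite -augE linearZ /= hcomp1. Qed.

Section Table.
Variables (p q : nat) (C : 'M[k]_(e * p, q)).

Definition table_gen (s : 'I_p) : table_mod hx C := (delta_mx 0 s, 0).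

Lemma table_combE (v : 'rV[R]_p) :
  \sum_s v 0 s *: table_gen s = (map_mx (aug G) v, mxvec (coef_mx v) *m C).
Proof.
have scaleE s : v 0 s *: table_gen s =
    (aug G (v 0 s) *: delta_mx 0 s, \sum_l coord1 hx (v 0 s) 0 l *: row s (table C l)).
  rewrite /GRing.scale /= /table_scale /= scaler0 add0r; congr pair.
  by apply: eq_bigr => l _; rewrite -rowE.
under eq_bigr do rewrite scaleE.
have pairE (I : Type) (s : seq I) (f : I -> 'rV[k]_p) (g : I -> 'rV[k]_q) :
    \sum_(i <- s) ((f i, g i) : table_mod hx C) = (\sum_(i <- s) f i, \sum_(i <- s) g i).
  elim: s => [|i s IH]; first by rewrite !big_nil.
  by rewrite !big_cons IH.
rewrite pairE; congr pair.
  by rewrite [RHS]row_sum_delta; apply: eq_bigr => s _; rewrite mxE.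
apply/rowP => h; rewrite mxvec_mulE exchange_big summxE; apply: eq_bigr => s _ /=.
by rewrite summxE; apply: eq_bigr => l _; rewrite !mxE.
Qed.

(** The part of degree one of the kernel of R^p -> R^C: the coefficients of v are
    indexed in the same way as the rows of C. *)
Definition table_syz (v : 'rV[R]_p) : Prop :=
  mxdeg 1 v /\ mxvec (coef_mx v) *m C = 0.

(** The first syzygies of R^C satisfy the condition that resolves them linearly.
    For b = z b' of degree two, the image of b' in R^C is also the image of some
    vector A of linear forms with z A in R_2 V', so z (b' - A) differs from b by an
    element of R_2 V', and b' - A is a syzygy.  Surjectivity of C, contained in
    the last hypothesis, makes R^C generated in degree zero. *)
Lemma linear_locus_criterion y z s (B : 'M[k]_(s, p)) : (0 < p)%N ->
  conca_pair y z ->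
  (forall t, mxvec ((coord1 hx y)^T *m row t B) *m C = 0) ->
  (forall w, exists A (a : 'rV[R]_s),
     [/\ mxvec A *m C = w, mxdeg 2 a & z *: lin_form_row A = a *m B^A]) ->
  linear_locus hx C.
Proof.
move=> p0 yz yB Csurj; have [y1 z1 yz0 yP zP] := yz.
have linK : lin_subspace table_syz.
  split=> [v []//||c u v [u1 uC] [v1 vC]].
    split; first exact: map_mx0.
    have -> : coef_mx (0 : 'rV_p) = 0 by apply/matrixP => i j; rewrite !mxE linear0 mxE.
    by rewrite linear0 mul0mx.
  split; first by apply: mxdegD => //; apply: (@mxdegZ 0 1) => //;
    apply/hcomp_base; exists c.
  have -> : coef_mx (c%:A *: u + v) = c *: coef_mx u + coef_mx v.
    by apply/matrixP => i j; rewrite !mxE mulr_algl linearP !mxE.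
  by rewrite linearP mulmxDl -scalemxAl uC vC scaler0 addr0.
have filtK : conca_filtered table_syz.
  exists y, z, s, B; split=> // [t|b b2].
    rewrite -map_row; split; last by rewrite coef_mxZ_lift.
    by apply: (@mxdegZ 1 0) => //; apply: mxdeg_lift.
  have [b' b'1 bE] := mxdeg2_lift zP b2.
  have [A [a [AE a2 zA]]] := Csurj (mxvec (coef_mx b') *m C).
  exists (b' - lin_form_row A), a; split=> //; last first.
    by rewrite -zA scalerBr subrK.
  have A1 : mxdeg 1 (- lin_form_row A) by apply/mxdegN/lin_form_row_deg.
  split; first exact: mxdegD.
  have -> : coef_mx (b' - lin_form_row A) = coef_mx b' - A.
    rewrite coef_mxD; congr (_ + _); rewrite -[in RHS](lin_form_rowK A).
    by apply/matrixP => i j; rewrite !mxE linearN mxE.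
  by rewrite linearB mulmxBl AE subrr.
have [n [d [pd dP]]] := presentation_of_subspace linK filtK.
apply: (koszul_of_presentation (gen := table_gen) (d := d)) => //.
- exists (table_gen (Ordinal p0)); apply/eqP => /(congr1 fst) /rowP.
  by move=> /(_ (Ordinal p0)); rewrite !mxE !eqxx => /eqP; rewrite oner_eq0.
- move=> w; have [A [_ [AE _ _]]] := Csurj w.2.
  exists (w.1^A + lin_form_row A); rewrite table_combE coef_mxD coef_mx_lift add0r.
  rewrite lin_form_rowK AE [LHS]surjective_pairing; congr pair.
  have -> : map_mx (aug G) (w.1^A + lin_form_row A) = w.1 + 0.
    rewrite map_mxD; congr (_ + _); first by apply/rowP => i; rewrite !mxE /= aug_alg.
    have /mxdegP A1 := lin_form_row_deg A; apply/rowP => i.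
    by rewrite mxE /= (@aug_in_degz _ _ G (Posz 1) _ (A1 0 i)) ?mxE.
  by rewrite addr0.
move=> v; rewrite dP table_combE; split=> [[v0 vC]|[v0 [_ vC]]].
  rewrite hc_lift v0 map_mx0; split=> //; split; first exact: mxdeg_hc.
  by rewrite coef_mx_hc.
congr pair; last by rewrite -coef_mx_hc.
by apply/rowP => i; apply: (@alg_inj _ R); move/rowP: v0 => /(_ i);
  rewrite !mxE /= augE scale0r.
Qed.

End Table.

(** * Three families of Koszul modules *)

Local Notation c0 := (coord1 hx z0).

Lemma z0_deg : in_deg G 1 z0.
Proof. by case: z0P. Qed.

Lemma lin_form_c0 : lin_form c0 = z0.
Proof. by apply: coord1K; apply: z0_deg. Qed.

Lemma c0_neq0 : c0 != 0.
Proof.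
have [/eqP z0n0 _ _ _] := z0P; apply/eqP => c00; apply: z0n0.
by rewrite -lin_form_c0 c00 /lin_form big1 // => l _; rewrite mxE scale0r.
Qed.

Lemma deg1_rank_gt0 : (0 < e)%N.
Proof.
case: (posnP e) => // e0; have := c0_neq0; case/negP; apply/eqP/rowP => l.
by have := ltn_ord l; rewrite {2}e0.
Qed.

Definition mul_form (r : nat) (T : 'I_e -> 'M[k]_(e, r)) (y : 'rV[k]_e) : 'M[k]_(e, r) :=
  \sum_l y 0 l *: T l.

Definition is_mul_form (r : nat) (T : 'I_e -> 'M[k]_(e, r)) : Prop :=
  (forall c y, lin_form c * lin_form y = 0 <-> c *m mul_form T y = 0) /\
  (forall y, row_full (mul_form T y) <->
     forall a, in_deg G 2 a -> exists2 b, in_deg G 1 b & a = lin_form y * b).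

(** Coordinates on R_2 turn multiplication by the linear form with coefficients y
    into a matrix whose entries depend linearly on y. *)
Lemma mul_form_ex r : has_rank (in_deg G 2) r ->
  exists T : 'I_e -> 'M[k]_(e, r), is_mul_form T.
Proof.
case=> b [b2 bP].
pose cb (c : 'rV[k]_r) := \sum_h c 0 h *: b h.
have cb_inj c c' : cb c = cb c' -> c = c'.
  move=> cc; have [|d [_ dP]] := bP (cb c).
    by rewrite /in_deg linear_sum; apply: eq_bigr => h _; rewrite linearZ /= b2.
  by rewrite -(dP _ (erefl _)) -(dP _ cc).
have cbP a : in_deg G 2 a -> exists c, a = cb c by move=> /bP [c [? _]]; exists c.
have cb2 c : in_deg G 2 (cb c).
  by rewrite /in_deg linear_sum; apply: eq_bigr => h _; rewrite linearZ /= b2.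
have cb_lin : linear cb.
  move=> t c c'; rewrite /cb scaler_sumr -big_split; apply: eq_bigr => h _ /=.
  by rewrite !mxE scalerDl scalerA.
pose cbL := GRing.isLinear.Build _ _ _ _ cb cb_lin.
pose cbl : {linear 'rV[k]_r -> R} := HB.pack cb cbL.
have cbE c : cb c = cbl c by [].
have /fin_all_exists [S SP] (ll : 'I_e * 'I_e) : exists c, x ll.1 * x ll.2 = cb c.
  by apply/cbP/(in_degM (hx.1 _) (hx.1 _)).
exists (fun l' => \matrix_l S (l, l')).
set T := fun l' => _.
have mulE c y : lin_form c * lin_form y = cb (c *m mul_form T y).
  rewrite /mul_form mulmx_sumr cbE linear_sum /lin_form mulr_sumr; apply: eq_bigr => l' _.
  rewrite -scalemxAr linearZ -scalerAr; congr (_ *: _).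
  rewrite mulmx_sum_row linear_sum mulr_suml; apply: eq_bigr => l _.
  by rewrite rowK [RHS]linearZ -scalerAl (SP (l, l')).
have cb0 : cb 0 = 0 by rewrite cbE linear0.
split=> [c y|y]; first by rewrite mulE; split=> [|->]; rewrite -?cb0 // => /cb_inj.
split=> [/row_fullP [B BT] a /cbP [c ->]|full].
  exists (lin_form (c *m B)); first exact: lin_form_deg.
  by rewrite mulrC mulE -mulmxA BT mulmx1.
apply/row_fullP.
have /fin_all_exists [f fP] (h : 'I_r) :
    exists c : 'rV[k]_e, c *m mul_form T y = delta_mx 0 h.
  have [a a1 aE] := full _ (cb2 (delta_mx 0 h)).
  by exists (coord1 hx a); apply: cb_inj; rewrite -mulE (coord1K a1) mulrC.
exists (\matrix_h f h); apply/row_matrixP => h.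
by rewrite row_mul rowK fP row1.
Qed.

Section Cases.
Variables (r : nat) (T : 'I_e -> 'M[k]_(e, r)).
Hypothesis TP : is_mul_form T.
Local Notation mu := (mul_form T).

Lemma mu_c0_full : row_full (mu c0).
Proof.
apply/(TP.2 c0) => a; rewrite lin_form_c0; exact: deg2_conca.
Qed.

Lemma c0_mu_c0 : c0 *m mu c0 = 0.
Proof. by apply/(TP.1 c0 c0); rewrite lin_form_c0; case: z0P => _ _ _; rewrite expr2. Qed.

Lemma conca_pair_lin_form y z : z *m mu y = 0 -> row_full (mu y) -> row_full (mu z) ->
  conca_pair (lin_form y) (lin_form z).
Proof.
move=> zy /(TP.2 y) yP /(TP.2 z) zP; split=> //; try exact: lin_form_deg.
by rewrite mulrC; apply/TP.1.
Qed.

Lemma lin_form_rowZ_eq0 p y (A : 'M[k]_(e, p)) :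
  (mu y)^T *m A = 0 -> lin_form y *: lin_form_row A = 0.
Proof.
move=> yA; apply/rowP => s; rewrite mxE lin_form_rowE mulrC !mxE.
have -> : \sum_l A l s *: x l = lin_form (col s A)^T.
  by apply: eq_bigr => l _; rewrite !mxE.
by apply/TP.1; rewrite tr_col -row_mul -[mu y]trmxK -trmx_mul yA trmx0 row0.
Qed.

Variables (p q : nat) (p0 : (0 < p)%N).

(** Modules killed by z0: here V' is all of k^p.  Such C of full rank q exist
    because the tables C with z0 R^C = 0 have columns in a space of dimension at
    least (e - 1) p, the common kernel of p linear forms. *)
Lemma linear_locus_nonempty : (q <= (e - 1) * p)%N ->
  exists C : 'M[k]_(e * p, q), linear_locus hx C.
Proof.
move=> le_q; pose L := lin_mx (mulmx c0) : 'M[k]_(e * p, 1 * p).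
have e0 := deg1_rank_gt0.
have [|H [freeH HL]] := @row_free_in_kermx k q _ _ L.
  by rewrite addnC -leq_subRL -?mulnBl // leq_mul.
have [H' HH'] := row_freeP freeH.
exists H^T.
apply: (linear_locus_criterion p0 conca_pair_diag (B := 1%:M)) => // [t|w].
  apply/row_matrixP => i; rewrite row0; apply/rowP => h.
  have HE : col h H^T = (mxvec (vec_mx (row h H)))^T by rewrite vec_mxK tr_row.
  have cH : c0 *m vec_mx (row h H) = 0.
    apply: (can_inj mxvecK); rewrite -mul_vec_lin vec_mxK linear0.
    by rewrite -row_mul HL row0.
  have -> (X : 'rV[k]_q) : row i X 0 h = (col h X) 0 0 by rewrite ord1 row_id mxE.
  by rewrite colE -mulmxA -colE HE mxvec_dotmul cH mul0mx !mxE.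
exists (vec_mx (w *m H'^T)), (z0 *: lin_form_row (vec_mx (w *m H'^T))).
rewrite vec_mxK -mulmxA -trmx_mul HH' trmx1 mulmx1 map_mx1 mulmx1; split=> //.
by apply: (@mxdegZ 1 1); [exact: z0_deg | exact: lin_form_row_deg].
Qed.

(** Modules whose part of degree one is the image of Ann(z0)_1 (x) k^p, a space of
    dimension (e - r) p: here V' = 0.  The rows of H are q independent elements of
    that space, and their images under C generically form a basis. *)
Lemma interior_annihilator : (q <= (e - r) * p)%N ->
  exists C : 'M[k]_(e * p, q), zariski_interior (@linear_locus k R G e x hx p q) C.
Proof.
move=> le_q; pose L := lin_mx (mulmx (mu c0)^T) : 'M[k]_(e * p, r * p).
have le_r : (r <= e)%N by rewrite -(eqP mu_c0_full) rank_leq_row.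
have [|H [freeH HL]] := @row_free_in_kermx k q _ _ L.
  by rewrite addnC -leq_subRL -?mulnBl // leq_mul.
have [C0 HC0] := row_freeP freeH.
exists C0; apply: (interior_of_polyfun (f := fun C => \det (H *m C))).
- apply: polyfun_det; apply: polymapM; first exact: polymap_const.
  by move=> i j; apply: polyfun_entry.
- move=> C; rewrite -unitfE -[_ \is a _]/(H *m C \in unitmx) => uHC.
  apply: (linear_locus_criterion p0 conca_pair_diag (B := 0 : 'M_(0, p))) => //.
    by case.
  move=> w; pose u := w *m invmx (H *m C) *m H.
  exists (vec_mx u), 0; rewrite vec_mxK /u -mulmxA mulmxKV //; split=> //.
    exact: map_mx0.
  rewrite mul0mx -lin_form_c0; apply: lin_form_rowZ_eq0; apply: (can_inj mxvecK).
  by rewrite -mul_vec_lin vec_mxK -mulmxA HL mulmx0 linear0.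
by rewrite HC0 det1 oner_neq0.
Qed.

Definition slice (n0 : 'I_p) (C : 'M[k]_(e * p, q)) : 'M[k]_(e, q) :=
  \matrix_(l, h) C (mxvec_index l n0) h.

Lemma mxvec_mul_slice n0 (c : 'rV[k]_e) (C : 'M[k]_(e * p, q)) :
  mxvec (c^T *m delta_mx 0 n0) *m C = c *m slice n0 C.
Proof.
apply/rowP => h; rewrite mxvec_mulE [RHS]mxE; apply: eq_bigr => l _.
rewrite (bigD1 n0) //= big1 ?addr0 => [|s /negPf sn].
  by rewrite !mxE big_ord1 !mxE !eqxx mulr1.
by rewrite !mxE big_ord1 !mxE sn andbF mulr0 mul0r.
Qed.

(** Modules whose part of degree one is R_1 u for the basis element u of index n0,
    and in which y kills u: here V' = k u.  Such a module is an extension of copies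
    of k by a cyclic module. *)
Lemma linear_locus_slice n0 y z (C : 'M[k]_(e * p, q)) :
  conca_pair (lin_form y) (lin_form z) -> y *m slice n0 C = 0 -> row_full (slice n0 C) ->
  linear_locus hx C.
Proof.
move=> yz yC /row_fullP [B BC].
apply: (linear_locus_criterion p0 yz (B := delta_mx 0 n0 : 'M_(1, p))) => // [t|w].
  by rewrite lin_formK ord1 row_id mxvec_mul_slice.
pose c := w *m B.
exists (c^T *m delta_mx 0 n0), (lin_form z *: lin_form_row c^T); split.
- by rewrite mxvec_mul_slice /c -mulmxA BC mulmx1.
- by apply: (@mxdegZ 1 1); [exact: lin_form_deg | exact: lin_form_row_deg].
by rewrite /lin_form_row map_mxM mulmxA scalemxAl.
Qed.

(** When q < e, some non-zero linear form y kills the basis element u, and then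
    some non-zero z satisfies y z = 0.  Both are taken as the polynomial kernel
    vectors built from adjugates, normalised so that y and z are the Conca generator
    at a table C0 in which it kills u.  If the determinants of A1, A2 and A3 do not
    vanish, then R_1 u = M_1 and y R_1 = z R_1 = R_2; this happens at C0, hence on
    an open set containing it. *)
Lemma interior_slice : (q <= e - 1)%N ->
  exists C : 'M[k]_(e * p, q), zariski_interior (@linear_locus k R G e x hx p q) C.
Proof.
move=> le_q; pose n0 := Ordinal p0.
have e0 := deg1_rank_gt0.
have [|H [freeH HL]] := @row_free_in_kermx k q _ _ c0^T.
  by rewrite addn1 -(subnK e0) addn1 ltnS.
have fullH : row_full H^T by rewrite /row_full mxrank_tr.
have cH : c0 *m H^T = 0 by rewrite -[LHS]trmxK trmx_mul trmxK HL trmx0.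
have [J1 [D1 [w1 [u1 w1E ker1 full1]]]] := adjugate_kernel fullH cH.
have [J2 [D2 [w2 [u2 w2E ker2 full2]]]] := adjugate_kernel mu_c0_full c0_mu_c0.
pose A1 C := slice n0 C *m J1 + D1.
pose y C := w1 *m \adj (A1 C).
pose A2 C := mu (y C) *m J2 + D2.
pose z C := w2 *m \adj (A2 C).
pose A3 C := mu (z C) *m J2 + D2.
pose C0 : 'M[k]_(e * p, q) := \matrix_(i, h) mxvec (\matrix_(l < e, s < p) H^T l h) 0 i.
have sC0 : slice n0 C0 = H^T by apply/matrixP => l h; rewrite !mxE mxvecE !mxE.
have poly_slice : polymap (slice n0).
  move=> i j; apply: polyfun_ext (polyfun_entry k (mxvec_index i n0) j) => C.
  by rewrite mxE.
have poly_mu g : polymap g -> polymap (fun C : 'M[k]_(e * p, q) => mu (g C)).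
  move=> gP i j.
  apply: (@polyfun_ext _ _ _ (fun C => \sum_l g C 0 l * T l i j)).
    by move=> C; rewrite summxE; apply: eq_bigr => l _; rewrite mxE.
  by apply: polyfun_sum => l; apply: polyfunM; [apply: gP | apply: polyfun_const].
have polyA1 : polymap A1.
  by apply: polymapD; [apply: polymapM => //; apply: polymap_const | apply: polymap_const].
have poly_y : polymap y by apply: polymapM; [apply: polymap_const | apply: polymap_adj].
have polyA2 : polymap A2.
  apply: polymapD; last exact: polymap_const.
  by apply: polymapM; [apply: poly_mu | apply: polymap_const].
have poly_z : polymap z by apply: polymapM; [apply: polymap_const | apply: polymap_adj].
have polyA3 : polymap A3.
  apply: polymapD; last exact: polymap_const.
  by apply: polymapM; [apply: poly_mu | apply: polymap_const].
exists C0.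
apply: (interior_of_polyfun (f := fun C => \det (A1 C) * (\det (A2 C) * \det (A3 C)))).
- by apply: polyfunM; [|apply: polyfunM]; apply: polyfun_det.
- move=> C; rewrite !mulf_eq0 !negb_or -!unitfE -!unitmxE => /and3P [uA1 uA2 uA3].
  apply: (@linear_locus_slice n0 (y C) (z C)); last exact: full1.
    by apply: conca_pair_lin_form; [apply: ker2 | apply: full2 | apply: full2].
  exact: ker1.
have yC0 : y C0 = c0 by rewrite /y /A1 sC0.
have zC0 : z C0 = c0 by rewrite /z /A2 yC0.
by rewrite /A1 /A2 /A3 zC0 yC0 sC0 !mulf_neq0 // -unitfE -unitmxE.
Qed.

End Cases.

End ConcaRing.
End KoszulTables.

Theorem theorem2 (k : fieldType) (R : comAlgType k) (G : std_grading R)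
    (hconca : exists z : R, conca_generator G z)
    (e : nat) (x : 'I_e -> R) (hx : is_basis (in_deg G 1) x)
    (r : nat) (hr : has_rank (in_deg G 2) r)
    (p q : nat) (hp : 1 <= p) :
  (q <= (e - 1) * p ->
     exists C : 'M[k]_(e * p, q), linear_locus hx C) /\
  (q <= maxn (e - 1) ((e - r) * p) ->
     exists C : 'M[k]_(e * p, q),
       zariski_interior (@linear_locus k R G e x hx p q) C).
Proof.
have [z0 z0P] := hconca; have [T TP] := mul_form_ex hx hr.
split=> [le_q|]; first exact: (linear_locus_nonempty z0P hx hp).
rewrite leq_max => /orP [le_q|le_q]; first exact: (interior_slice z0P hx TP hp).
exact: (interior_annihilator z0P hx TP hp).
Qed.
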